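(* Let $(\rho_k)_{k}$ be a sequence in $\mathcal R$ and let $\rho\in\mathcal R$. The following are equivalent: 1. $Q_{\rho_k}\to Q_\rho$ strongly on $\mathcal H$, i.e. $Q_{\rho_k}u\to Q_\rho u$ in $\mathcal H$ for every $u\in\mathcal H$; 2. for every measurable $B\subset X$ with $\lambda(B)<\infty$, $\lambda\bigl((E_{\rho_k}\triangle E_\rho)\cap B\bigr)\to 0$; 3. $\mathbf 1_{E_{\rho_k}}\to\mathbf 1_{E_\rho}$ locally in measure.
   Context: Let $X=\mathbb R^n$ ($n\ge 1$) with its Borel $\sigma$-algebra and Lebesgue measure $\lambda$; functions are complex-valued. Let $\mathcal H=L^2(X,\lambda)$ and $\mathcal R=\{\rho\in L^1(X,\lambda):\rho\ge 0\ \lambda\text{-a.e.},\ \int_X\rho\,d\lambda=1\}$. For $\rho\in\mathcal R$ let $E_\rho=\{\rho>0\}$ (defined up to null sets) and let $Q_\rho\in\mathcal B(\mathcal H)$ be the orthogonal projection $Q_\rho u=\mathbf 1_{E_\rho}u$. Functions $g_k$ converge to $g$ locally in measure if, for every measurable $B$ with $\lambda(B)<\infty$ and every $\varepsilon>0$, $\lambda(\{x\in B:|g_k(x)-g(x)|>\varepsilon\})\to0$. $\triangle$ denotes symmetric difference. *)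

(* Defs.v *)
From HB Require Import structures.
From mathcomp Require Import all_boot all_order all_algebra.
From mathcomp Require Import all_classical all_reals all_analysis.
From mathcomp Require Import measurable_realfun complex.

Set Implicit Arguments.
Unset Strict Implicit.
Unset Printing Implicit Defensive.
Import Order.TTheory GRing.Theory Num.Theory.
Import numFieldNormedType.Exports.
Local Open Scope classical_set_scope.
Local Open Scope ring_scope.

Section image_measure.
Context d d' (T : measurableType d) (T' : measurableType d') (R : realType).
Variables (mu : {measure set T -> \bar R}) (f : {mfun T >-> T'}).

Definition image_measure : set T' -> \bar R := pushforward mu f.

Let image_measure0 : image_measure set0 = 0%E.
Proof. exact: measure0. Qed.

Let image_measure_ge0 A : (0 <= image_measure A)%E.
Proof. exact: measure_ge0. Qed.

Let image_measure_sigma_additive : semi_sigma_additive image_measure.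
Proof.
by move=> F mF tF mUF; apply: (@measure_semi_sigma_additive _ _ _
  (pushforward mu f)).
Qed.

HB.instance Definition _ := isMeasure.Build _ _ _ image_measure
  image_measure0 image_measure_ge0 image_measure_sigma_additive.

End image_measure.

(* The n-fold product of the one-dimensional Lebesgue measure, on tuples with
   the product sigma-algebra. *)
Section lebesgue_tuple.
Context {R : realType}.
Local Notation RT := (measurableTypeR R).

Definition tcons n (p : RT * n.-tuple RT) : n.+1.-tuple RT :=
  [tuple of p.1 :: p.2].

Let measurable_tcons n : measurable_fun [set: RT * n.-tuple RT] (@tcons n).
Proof. exact: measurable_cons. Qed.

HB.instance Definition _ n :=
  isMeasurableFun.Build _ _ _ _ (@tcons n) (@measurable_tcons n).

Section step.
Variables (n : nat) (mu : {sigma_finite_measure set (n.-tuple RT) -> \bar R}).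

Definition tcons_measure : set (n.+1.-tuple RT) -> \bar R :=
  image_measure (@lebesgue_measure R \x mu)%E (@tcons n).

HB.instance Definition _ := Measure.on tcons_measure.

Let tcons_measure_sigma_finite : sigma_finite setT tcons_measure.
Proof.
have /sigma_finiteP[F [UF ndF mF]] := sigma_finiteT (@lebesgue_measure R).
have /sigma_finiteP[G [UG ndG mG]] := sigma_finiteT mu.
pose g (t : n.+1.-tuple RT) : RT * n.-tuple RT := (thead t, [tuple of behead t]).
have gK : cancel g (@tcons n).
  by move=> t; rewrite [RHS]tuple_eta; apply: val_inj.
have Kg : cancel (@tcons n) g.
  by move=> [x t]; rewrite /g /tcons/= theadE; congr pair; apply: val_inj.
have mg : measurable_fun setT g.
  apply/measurable_fun_pairP; split; first exact: measurable_tnth.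
  exact: measurable_behead.
exists (fun k => g @^-1` (F k `*` G k)).
  rewrite -preimage_bigcup (_ : \bigcup_k (F k `*` G k) = setT)//.
  apply/seteqP; split => // -[x t] _.
  have [i _ Fx] : (\bigcup_k F k) x by rewrite -UF.
  have [j _ Gt] : (\bigcup_k G k) t by rewrite -UG.
  exists (maxn i j) => //; split => /=.
    by move: x Fx; exact/subsetPset/ndF/leq_maxl.
  by move: t Gt; exact/subsetPset/ndG/leq_maxr.
move=> k; have [mFk Fk] := mF k; have [mGk Gk] := mG k; split.
  by rewrite -[X in measurable X]setTI; apply: mg => //; exact: measurableX.
rewrite /tcons_measure /image_measure /pushforward -comp_preimage.
rewrite (_ : g \o @tcons n = id); last by apply/funext => p; exact: Kg.
by rewrite preimage_id /= product_measure1E// lte_mul_pinfty// ge0_fin_numE.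
Qed.

HB.instance Definition _ := Measure_isSigmaFinite.Build _ _ _ tcons_measure
  tcons_measure_sigma_finite.
End step.

Fixpoint lebesgue_tuple n :
    {sigma_finite_measure set (n.-tuple RT) -> \bar R} :=
  if n is m.+1 then
    [the {sigma_finite_measure set _ -> \bar _} of
      tcons_measure (lebesgue_tuple m)]
  else [the {sigma_finite_measure set _ -> \bar _} of \d_ [tuple] ].

Lemma lebesgue_tuple_rect n (A : 'I_n -> set RT) :
  (forall i, measurable (A i)) ->
  lebesgue_tuple n [set t | forall i, A i (tnth t i)] =
  (\prod_(i < n) lebesgue_measure (A i))%E.
Proof.
elim: n A => [|n IHn] A mA /=.
  by rewrite big_ord0 diracE mem_set// => -[].
rewrite big_ord_recl -IHn// -product_measure1E//; last first.
  rewrite (_ : [set _ | _] = \bigcap_(i in [set: 'I_n])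
    ((@tnth n RT)^~ i) @^-1` A (lift ord0 i)); last first.
    by apply/seteqP; split => t At i; [move=> _; exact: At|exact: At].
  apply: fin_bigcap_measurable => // i _.
  by rewrite -[X in measurable X]setTI; exact: measurable_tnth.
congr product_measure1; apply/seteqP; split => -[x t]/= At.
  split=> [|i]; first by have := At ord0.
  by have := At (lift ord0 i); rewrite tnthS.
by case: At => Ax At i; case: (unliftP ord0 i) => [j|] ->; rewrite ?tnthS.
Qed.

End lebesgue_tuple.

Section borel_rV.
Context {R : realType} (n : nat).

(* R^n with the sigma-algebra generated by its open sets. *)
Definition Rn : Type := g_sigma_algebraType (@open 'rV[R]_n).
HB.instance Definition _ := Measurable.on Rn.

Definition row_of_tuple (t : n.-tuple (measurableTypeR R)) : Rn :=
  \row_i tnth t i.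

Let measurable_row_of_tuple : measurable_fun setT row_of_tuple.
Proof.
apply: measurability => // _ [U oU <-]; rewrite setTI.
pose box (p : 'rV[rat]_n * nat) : set (n.-tuple (measurableTypeR R)) :=
  \bigcap_(i in [set: 'I_n])
    ((@tnth n _)^~ i) @^-1` ball (ratr (p.1 ord0 i) : R) (p.2.+1%:R^-1 : R).
have mbox p : measurable (box p).
  apply: fin_bigcap_measurable => //.
  move=> i _; rewrite -[X in measurable X]setTI.
  apply: measurable_tnth => //; exact: measurable_ball.
rewrite (_ : _ @^-1` U = \bigcup_(p in [set: 'rV[rat]_n * nat])
    if `[< box p `<=` row_of_tuple @^-1` U >] then box p else set0); last first.
  apply/seteqP; split => [t /= Ut|t [p _]]; last first.
    by case: ifPn => // /asboolP; exact.
  have /nbhs_ballP[e /= e0 eU] : nbhs (row_of_tuple t) U by exact: open_nbhs_nbhs.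
  pose k := Num.truncn (2 / e).
  have ke : (k.+1%:R^-1 : R) < e / 2.
    by rewrite -[ltRHS]invrK ltf_pV2 ?posrE// ?invr_gt0 ?divr_gt0// invf_div truncnS_gt.
  have k0 : (0 : R) < k.+1%:R^-1 by [].
  have qP (i : 'I_n) : {q : rat | `|(tnth t i : R) - ratr q| < k.+1%:R^-1}.
    apply: cid; have /rat_in_itvoo[q] : (tnth t i : R) - k.+1%:R^-1 < tnth t i + k.+1%:R^-1.
      by rewrite ltrBlDr -addrA ltrDl addr_gt0.
    by rewrite in_itv/= -ltr_distlC => qt; exists q.
  exists (\row_i sval (qP i), k) => //.
  have bt : box (\row_i sval (qP i), k) t.
    move=> i _; rewrite /= mxE /ball/= distrC; exact: (svalP (qP i)).
  rewrite ifT//; apply/asboolP => s sb; apply: eU; split => // i j.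
  rewrite !mxE; have := sb j I; have := bt j I; rewrite /= mxE => tj sj.
  rewrite (splitr e); apply: (@ball_triangle _ R (ratr (sval (qP j)))).
    by apply: le_ball (ltW ke) _ _; exact/ball_sym.
  exact: le_ball (ltW ke) _ _.
apply: countable_bigcupT_measurable => [|p]; first exact: countableP.
by case: ifPn.
Qed.

HB.instance Definition _ :=
  isMeasurableFun.Build _ _ _ _ row_of_tuple measurable_row_of_tuple.

(* Lebesgue measure on R^n: the product measure transported to row vectors;
   lebesgue_Rn_box below is its characteristic property. *)
Definition lebesgue_Rn : set Rn -> \bar R :=
  image_measure (@lebesgue_tuple R n) row_of_tuple.

HB.instance Definition _ := Measure.on lebesgue_Rn.

Lemma lebesgue_Rn_box (a b : 'rV[R]_n) : (forall i, a ord0 i <= b ord0 i) ->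
  lebesgue_Rn [set x : Rn | forall i, x ord0 i \in `[a ord0 i, b ord0 i]] =
  (\prod_i (b ord0 i - a ord0 i))%:E.
Proof.
move=> ab; rewrite -prodEFin.
transitivity (\prod_(i < n) lebesgue_measure `[a ord0 i, b ord0 i]%classic)%E.
  rewrite -lebesgue_tuple_rect; last by move=> i; exact: measurable_itv.
  congr (lebesgue_tuple _ _); apply/seteqP; split => t /= tab i; have := tab i;
    by rewrite mxE.
apply: eq_bigr => i _; rewrite lebesgue_measure_itv/= lte_fin.
by case: ltgtP (ab i) => // ->; rewrite subrr.
Qed.

End borel_rV.
Arguments Rn R n : clear implicits.
Arguments lebesgue_Rn {R n}.

Section complex_L2.
Context d (T : measurableType d) (R : realType).
Variable mu : {measure set T -> \bar R}.
Local Notation normc := (@ComplexField.Normc.normc R).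
Implicit Types (u v : T -> R[i]) (a : R[i]).

Definition complex_measurable u :=
  measurable_fun setT (@complex.Re R \o u) /\
  measurable_fun setT (@complex.Im R \o u).

Let normc_ge0 a : 0 <= normc a.
Proof. by case: a => x y; exact: sqrtr_ge0. Qed.

Definition square_integrable : {pred T -> R[i]} :=
  mem [set u | complex_measurable u /\ finite_norm mu 2%:E (normc \o u)].

Lemma measurable_normc u :
  complex_measurable u -> measurable_fun setT (normc \o u).
Proof.
move=> [mRe mIm].
rewrite (_ : _ \o _ = fun x => ((complex.Re (u x)) ^+ 2 + (complex.Im (u x)) ^+ 2) `^ 2^-1).
  apply: (measurableT_comp (measurable_powR _)).
  by apply: measurable_funD; apply: measurable_funX.
by apply/funext => x /=; rewrite powR12_sqrt ?addr_ge0 ?sqr_ge0//; case: (u x).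
Qed.

Lemma complex_measurableD u v : complex_measurable u -> complex_measurable v ->
  complex_measurable (u + v).
Proof.
move=> [uR uI] [vR vI]; split.
  rewrite (_ : _ \o _ = (@complex.Re R \o u) \+ (@complex.Re R \o v)).
    exact: measurable_funD.
  by apply/funext => x /=; rewrite fctE; case: (u x) => ? ?; case: (v x).
rewrite (_ : _ \o _ = (@complex.Im R \o u) \+ (@complex.Im R \o v)).
  exact: measurable_funD.
by apply/funext => x /=; rewrite fctE; case: (u x) => ? ?; case: (v x).
Qed.

Lemma complex_measurableM u v : complex_measurable u -> complex_measurable v ->
  complex_measurable (u \* v).
Proof.
move=> [uR uI] [vR vI]; split.
  rewrite (_ : _ \o _ = (@complex.Re R \o u) \* (@complex.Re R \o v) \-
                        (@complex.Im R \o u) \* (@complex.Im R \o v)).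
    by apply: measurable_funB; exact: measurable_funM.
  by apply/funext => x /=; case: (u x) => ? ?; case: (v x).
rewrite (_ : _ \o _ = (@complex.Re R \o u) \* (@complex.Im R \o v) \+
                      (@complex.Im R \o u) \* (@complex.Re R \o v)).
  by apply: measurable_funD; exact: measurable_funM.
by apply/funext => x /=; case: (u x) => ? ?; case: (v x).
Qed.

Lemma complex_measurable_cst a : complex_measurable (cst a).
Proof. by split; exact: measurable_cst. Qed.

Lemma complex_measurable_indic (E : set T) : measurable E ->
  complex_measurable (\1_E : T -> R[i]).
Proof.
move=> mE; split.
  rewrite (_ : _ \o _ = \1_E); first exact: measurable_indic.
  by apply/funext => x /=; rewrite !indicE; case: (x \in E).
rewrite (_ : _ \o _ = cst 0); first exact: measurable_cst.
by apply/funext => x /=; rewrite !indicE; case: (x \in E).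
Qed.

Lemma le_Lnorm2 (f g : T -> R) : measurable_fun setT f -> measurable_fun setT g ->
  (forall x, `|f x| <= `|g x|) ->
  ('N[mu]_2%:E[EFin \o f] <= 'N[mu]_2%:E[EFin \o g])%E.
Proof.
move=> mf mg fg.
have mp (h : T -> R) : measurable_fun setT h ->
    measurable_fun setT (fun x => `|h x| `^ 2)%R.
  by move=> mh; apply: (measurableT_comp (measurable_powR _)); exact: measurableT_comp.
rewrite unlock; apply: gt0_ler_poweR; rewrite ?invr_ge0//.
- by rewrite in_itv/= leey andbT integral_ge0.
- by rewrite in_itv/= leey andbT integral_ge0.
apply: ge0_le_integral => //=.
- by apply/measurable_EFinP; exact: mp.
- by apply/measurable_EFinP; exact: mp.
- by move=> x _; rewrite lee_fin ge0_ler_powR// nnegrE.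
Qed.

Lemma Lnorm2_normcD u v : complex_measurable u -> complex_measurable v ->
  ('N[mu]_2%:E[EFin \o (normc \o (u + v)%R)] <=
   'N[mu]_2%:E[EFin \o (normc \o u)] + 'N[mu]_2%:E[EFin \o (normc \o v)])%E.
Proof.
move=> mu_ mv.
apply: le_trans (eminkowski _ (measurable_normc mu_) (measurable_normc mv) _).
  apply: le_Lnorm2.
  - exact/measurable_normc/complex_measurableD.
  - by apply: measurable_funD; exact: measurable_normc.
  - move=> x /=; rewrite !ger0_norm ?addr_ge0 ?normc_ge0//.
    exact: le_normcD.
by rewrite lee_fin ler1n.
Qed.

Lemma Lnorm2_normcZ a u : complex_measurable u ->
  ('N[mu]_2%:E[EFin \o (normc \o (a *: u)%R)] =
   (normc a)%:E * 'N[mu]_2%:E[EFin \o (normc \o u)])%E.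
Proof.
move=> mu_; rewrite unlock.
have mp : measurable_fun setT (fun x => `|normc (u x)| `^ 2)%R.
  apply: (measurableT_comp (measurable_powR _)); apply: measurableT_comp => //.
  exact: measurable_normc.
under eq_integral => x _ do rewrite /= ComplexField.Normc.normcM normrM powRM// EFinM.
under [in RHS]eq_integral => x _ do rewrite /=.
rewrite ge0_integralZl_EFin ?powR_ge0//; last first.
- exact/measurable_EFinP.
rewrite poweRM ?integral_ge0// poweR_EFin -powRrM mulfV ?powRr1//.
by rewrite ger0_norm// normc_ge0.
Qed.

Lemma square_integrable_submod : submod_closed square_integrable.
Proof.
split.
  rewrite inE /=; split; first exact: (complex_measurable_cst 0).
  rewrite (_ : normc \o 0 = cst 0) ?/finite_norm ?Lnorm0//.
  by apply/funext => x; exact: ComplexField.Normc.normc0.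
move=> a u v /[!inE]/= -[um uf] [vm vf].
have am : complex_measurable (a *: u).
  exact: (complex_measurableM (complex_measurable_cst a) um).
split; first exact: complex_measurableD.
apply: le_lt_trans (Lnorm2_normcD am vm) _; rewrite lte_add_pinfty//.
by rewrite Lnorm2_normcZ// lte_mul_pinfty// lee_fin normc_ge0.
Qed.

HB.instance Definition _ := GRing.isSubmodClosed.Build _ _ square_integrable
  square_integrable_submod.

Record L2fun := MkL2fun {
  L2fun_val :> T -> R[i];
  L2funP : L2fun_val \in square_integrable }.

HB.instance Definition _ := [isSub for L2fun_val].
HB.instance Definition _ := [Choice of L2fun by <:].
HB.instance Definition _ := [SubChoice_isSubLmodule of L2fun by <:].

Definition ae_null : {pred L2fun} :=
  mem [set u : L2fun | {ae mu, forall x, u x = 0}].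

Lemma ae_null_zmod : zmod_closed ae_null.
Proof.
split; first by rewrite inE /=; apply: aeW.
move=> u v /[!inE]/=; apply: filterS2 => x ux vx.
by rewrite !fctE ux vx subr0.
Qed.

HB.instance Definition _ := GRing.isZmodClosed.Build _ ae_null ae_null_zmod.

Local Open Scope quotient_scope.

(* L^2(T, mu; C): square-integrable functions modulo a.e. equality. It is a
   module over R[i], and its norm takes values in R, so the norm and the
   topology are those of a normedZmodType over R. *)
Definition L2 : Type := @Quotient.quot L2fun ae_null.
HB.instance Definition _ := GRing.Zmodule.on L2.
HB.instance Definition _ := EqQuotient.on L2.

Lemma L2_eqP (u v : L2fun) :
  \pi_L2 u = \pi_L2 v <-> {ae mu, forall x, u x = v x}.
Proof.
split=> [/eqP|uv].
  rewrite -Quotient.idealrBE inE /=; apply: filterS => x /eqP.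
  by rewrite subr_eq0 => /eqP.
apply/eqP; rewrite -Quotient.idealrBE inE /=; apply: filterS uv => x.
by rewrite !fctE => ->; rewrite subrr.
Qed.

Lemma L2_repr (u : L2fun) : {ae mu, forall x, (repr (\pi_L2 u) : L2fun) x = u x}.
Proof. by apply/L2_eqP; rewrite reprK. Qed.

Definition L2norm (U : L2) : R :=
  fine 'N[mu]_2%:E[EFin \o (normc \o (repr U : L2fun))].

Lemma L2normE (u : L2fun) :
  (L2norm (\pi_L2 u))%:E = 'N[mu]_2%:E[EFin \o (normc \o u)]%E.
Proof.
have [um uf] := set_mem (L2funP u).
have [vm vf] := set_mem (L2funP (repr (\pi_L2 u))).
rewrite /L2norm fineK ?ge0_fin_numE ?Lnorm_ge0//.
rewrite unlock; congr poweR; apply: ae_eq_integral => //.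
- apply/measurable_EFinP; apply: (measurableT_comp (measurable_powR _)).
  by apply: measurableT_comp => //; exact: measurable_normc.
- apply/measurable_EFinP; apply: (measurableT_comp (measurable_powR _)).
  by apply: measurableT_comp => //; exact: measurable_normc.
- by apply: filterS (L2_repr u) => x ux _ /=; rewrite ux.
Qed.

Lemma L2normD (U V : L2) : L2norm (U + V) <= L2norm U + L2norm V.
Proof.
rewrite -[U]reprK -[V]reprK.
have [um _] := set_mem (L2funP (repr U)); have [vm _] := set_mem (L2funP (repr V)).
rewrite -(raddfD \pi_L2) -lee_fin EFinD !L2normE.
exact: Lnorm2_normcD.
Qed.

Lemma L2norm_eq0 (U : L2) : L2norm U = 0 -> U = 0.
Proof.
rewrite -[U]reprK; set u := repr U => U0.
have u0 : 'N[mu]_2%:E[EFin \o (normc \o u)]%E = 0%E by rewrite -L2normE U0.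
have [um _] := set_mem (L2funP u).
rewrite -(raddf0 \pi_L2); apply/L2_eqP.
have mu' : measurable_fun setT (EFin \o (normc \o u)).
  exact/measurable_EFinP/measurable_normc.
have p2 : (0 < 2%:E :> \bar R)%E by rewrite lte_fin.
have := Lnorm_eq0_eq0 mu' p2 u0; apply: filterS => x ux.
apply: ComplexField.Normc.eq0_normc; apply: EFin_inj; exact: ux.
Qed.

Lemma L2scale_key (a : R[i]) (u v : L2fun) :
  \pi_L2 u = \pi_L2 v -> \pi_L2 (a *: u) = \pi_L2 (a *: v).
Proof. by move=> /L2_eqP uv; apply/L2_eqP; apply: filterS uv => x; exact: (congr1 ( *%R a)). Qed.

Definition L2scale (a : R[i]) (U : L2) : L2 := \pi_L2 (a *: (repr U : L2fun)).

Lemma L2scaleE a (u : L2fun) : L2scale a (\pi_L2 u) = \pi_L2 (a *: u).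
Proof. by apply: L2scale_key; rewrite reprK. Qed.

Let L2scaleA a b (U : L2) : L2scale a (L2scale b U) = L2scale (a * b) U.
Proof.
by elim/quotW: U => u; rewrite [L2scale b _]L2scaleE !L2scaleE scalerA.
Qed.

Let L2scale1 : left_id 1 L2scale.
Proof. by move=> U; rewrite -[U]reprK L2scaleE scale1r. Qed.

Let L2scaleDr : right_distributive L2scale +%R.
Proof.
by move=> a U V; rewrite -[U]reprK -[V]reprK -raddfD !L2scaleE scalerDr raddfD.
Qed.

Let L2scaleDl (U : L2) : {morph L2scale^~ U : a b / a + b}.
Proof. by move=> a b; rewrite -[U]reprK !L2scaleE scalerDl raddfD. Qed.

HB.instance Definition _ := GRing.Zmodule_isLmodule.Build R[i] L2
  L2scaleA L2scale1 L2scaleDr L2scaleDl.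

Lemma pi_L2Z a (u : L2fun) : \pi_L2 (a *: u) = a *: \pi_L2 u.
Proof. by rewrite -L2scaleE. Qed.

Lemma L2normZ (a : R[i]) (U : L2) : L2norm (a *: U) = normc a * L2norm U.
Proof.
rewrite -[U]reprK -pi_L2Z; apply: EFin_inj.
have [um _] := set_mem (L2funP (repr U)).
by rewrite EFinM !L2normE; exact: Lnorm2_normcZ.
Qed.

Let L2normMn (U : L2) n : L2norm (U *+ n) = L2norm U *+ n.
Proof.
rewrite -scaler_nat L2normZ -[n%:R](rmorph_nat (real_complex R)) /=.
by rewrite expr0n addr0 sqrtr_sqr normr_nat mulr_natl.
Qed.

Let L2normN (U : L2) : L2norm (- U) = L2norm U.
Proof.
by rewrite -scaleN1r L2normZ /= oppr0 expr0n addr0 sqrrN expr1n sqrtr1 mul1r.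
Qed.

HB.instance Definition _ := Num.Zmodule_isNormed.Build R L2
  L2normD L2norm_eq0 L2normMn L2normN.
HB.instance Definition _ := PseudoMetric.copy L2 (pseudoMetric_normed L2).
HB.instance Definition _ := isPointed.Build L2 0.
HB.instance Definition _ := NormedZmod_PseudoMetric_eq.Build R L2 erefl.

End complex_L2.

Section density.
Context d (T : measurableType d) (R : realType).
Variable mu : {measure set T -> \bar R}.
Local Notation normc := (@ComplexField.Normc.normc R).
Local Open Scope quotient_scope.

(* Densities are functions, not a.e.-classes: a statement about all densities
   covers every choice of representative. The set {rho > 0} depends on that
   choice only up to a null set, and Qproj not at all (Qproj_ae_eq). *)
Record density := Density {
  density_fun :> LfunType mu (lexx 1%E);
  density_ge0 : {ae mu, forall x, 0 <= density_fun x};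
  density_int1 : (\int[mu]_x (density_fun x)%:E = 1)%E }.

Definition pos_set (rho : density) : set T := [set x | 0 < rho x].

Lemma measurable_pos_set rho : measurable (pos_set rho).
Proof.
rewrite (_ : pos_set rho = rho @^-1` `]0, +oo[%classic).
  exact: measurable_funPTI.
by apply/seteqP; split => x /=; rewrite in_itv/= andbT.
Qed.

Lemma square_integrable_pos_set rho (u : L2fun mu) :
  (\1_(pos_set rho) \* u : T -> R[i]) \in square_integrable mu.
Proof.
have [um uf] := set_mem (L2funP u).
have rum := complex_measurableM
  (complex_measurable_indic R (measurable_pos_set rho)) um.
rewrite inE /=; split => //; apply: le_lt_trans uf; apply: le_Lnorm2.
- exact: measurable_normc.
- exact: measurable_normc.
move=> x /=; rewrite indicE; case: (x \in _); rewrite ?mul1r// mul0r.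
by rewrite ComplexField.Normc.normc0 normr0.
Qed.

Definition mul_pos_set rho (u : L2fun mu) : L2fun mu :=
  MkL2fun (square_integrable_pos_set rho u).

(* u |-> 1_{rho > 0} u on classes; by Qproj_idem and Qproj_contraction it is an
   orthogonal projection. *)
Definition Qproj rho (U : L2 mu) : L2 mu := \pi_(L2 mu) (mul_pos_set rho (repr U)).

Lemma QprojE rho (u : L2fun mu) :
  Qproj rho (\pi_(L2 mu) u) = \pi_(L2 mu) (mul_pos_set rho u).
Proof.
apply/L2_eqP; apply: filterS (L2_repr u) => x.
exact: (congr1 ( *%R _)).
Qed.

Lemma Qproj_ae_eq (rho rho' : density) :
  {ae mu, forall x, rho x = rho' x} -> Qproj rho =1 Qproj rho'.
Proof.
move=> rr' U; apply/L2_eqP; apply: filterS rr' => x rx /=.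
congr (_ * _); rewrite !indicE; congr ((_ : bool)%:R).
by apply/idP/idP; rewrite !inE /pos_set /= rx.
Qed.

Lemma Qproj_is_linear rho : linear (Qproj rho).
Proof.
move=> a U V; elim/quotW: U => u; elim/quotW: V => v.
rewrite -pi_L2Z -raddfD !QprojE -pi_L2Z -raddfD; congr \pi; apply: val_inj.
by apply/funext => x /=; rewrite !fctE mulrDr mulrCA.
Qed.

HB.instance Definition _ rho :=
  GRing.isLinear.Build R[i] (L2 mu) (L2 mu) _ (Qproj rho) (Qproj_is_linear rho).

Lemma Qproj_idem rho (U : L2 mu) : Qproj rho (Qproj rho U) = Qproj rho U.
Proof.
elim/quotW: U => u; rewrite [Qproj rho (\pi _)]QprojE QprojE; congr \pi; apply: val_inj.
apply/funext => x /=; rewrite indicE; case: (x \in _).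
  by rewrite !mul1r.
by rewrite !mul0r.
Qed.

Lemma Qproj_contraction rho (U : L2 mu) : `|Qproj rho U| <= `|U|.
Proof.
elim/quotW: U => u; rewrite QprojE -lee_fin !L2normE; apply: le_Lnorm2.
- by have [um _] := set_mem (L2funP (mul_pos_set rho u)); exact: measurable_normc.
- by have [um _] := set_mem (L2funP u); exact: measurable_normc.
move=> x /=; rewrite indicE; case: (x \in _); rewrite ?mul1r// mul0r.
by rewrite ComplexField.Normc.normc0 normr0.
Qed.

Definition cvg_locally_in_measure (g_ : nat -> T -> R[i]) (g : T -> R[i]) :=
  forall (B : set T) (e : R), measurable B -> (mu B < +oo)%E -> 0 < e ->
    mu [set x | B x /\ e < normc (g_ k x - g x)] @[k --> \oo] --> 0%E.

End density.

(* Main.v *)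
(** On classes, [|Qproj r u - Qproj s u|^2] is the integral of [|u|^2] over the
    symmetric difference of [{r > 0}] and [{s > 0}]. Testing on [u = 1_B] turns
    strong convergence into local convergence of the sets, which for indicators
    is convergence locally in measure. Conversely, up to a small part of its
    integral, [|u|^2] lives on a set [C = {1/m < |u|^2 <= m}], which has finite
    measure and on which [|u|^2] is bounded, so local convergence on [C]
    suffices. *)
Require Import Defs.
From HB Require Import structures.
From mathcomp Require Import all_boot all_order all_algebra.
From mathcomp Require Import all_classical all_reals all_analysis.
From mathcomp Require Import measurable_realfun complex.
Import Order.TTheory GRing.Theory Num.Theory.
Import numFieldNormedType.Exports.
Local Open Scope classical_set_scope.
Local Open Scope ring_scope.

(** Lets limits in the extended reals be handled by strict real bounds; the bound for [e = 1]
    already makes the terms eventually finite. *)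
Lemma ge0_cvge0P (R : realType) (a : (\bar R)^nat) :
  (forall k, 0 <= a k)%E ->
  a k @[k --> \oo] --> 0%E <->
  (forall e : R, 0 < e -> \forall k \near \oo, (a k < e%:E)%E).
Proof.
move=> a0; split=> [/fine_cvgP[afin acvg] e e0|ae].
  have /cvgr0Pnorm_lt/(_ _ e0) ae := acvg.
  near=> k; rewrite -(fineK (near afin k _))// lte_fin.
  by apply: le_lt_trans (ler_norm _) _; near: k.
have afin : \forall k \near \oo, a k \is a fin_num.
  apply: filterS (ae 1 ltr01) => k ak.
  by rewrite ge0_fin_numE// (lt_trans ak)// ltry.
apply/fine_cvgP; split => //; apply/cvgr0Pnorm_lt => e e0.
near=> k; rewrite ger0_norm ?fine_ge0// -lte_fin fineK; near: k => //.
exact: ae.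
Unshelve. all: by end_near. Qed.

(** The sets [A k] may keep infinite measure, so [f] is cut along [C m]: the integral over the
    complement of [C m] is small for large [m], uniformly in [k], and on [C m] the integral is at
    most [(m+1) * mu (A k]&[C m)]. *)
Lemma cvg_integral_local0 d (T : measurableType d) (R : realType)
    (mu : {measure set T -> \bar R}) (f : T -> R) (A : (set T)^nat) :
  measurable_fun setT f -> (forall x, 0 <= f x) ->
  (\int[mu]_x (f x)%:E < +oo)%E ->
  (forall k, measurable (A k)) ->
  (forall B, measurable B -> (mu B < +oo)%E ->
    mu (A k `&` B) @[k --> \oo] --> 0%E) ->
  (\int[mu]_(x in A k) (f x)%:E)%E @[k --> \oo] --> 0%E.
Proof.
move=> mf f0 foo mA A0.
have mEf : measurable_fun setT (EFin \o f) by exact/measurable_EFinP.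
(* The sets [C m] increase to the set where [f] is positive; the shift to [m+1] keeps the lower
   bound meaningful at [m = 0]. *)
pose C m := f @^-1` `]m.+1%:R^-1, m.+1%:R]%classic.
have mC m : measurable (C m) by rewrite -[C m]setTI; exact: mf.
have muC m : (mu (C m) < +oo)%E.
  (* Chebyshev's inequality: [f] exceeds [1/(m+1)] on [C m]. *)
  have : (m.+1%:R^-1%:E * mu (C m) <= \int[mu]_x (f x)%:E)%E.
    rewrite -integral_cst//.
    apply: (@le_trans _ _ (\int[mu]_(x in C m) (f x)%:E)%E); last first.
      by apply: ge0_subset_integral => // x _; rewrite lee_fin.
    apply: ge0_le_integral => //.
    - by move=> x _; rewrite lee_fin.
    - exact: (measurable_funTS mEf).
    - by move=> x; rewrite /C/= in_itv/= => /andP[/ltW].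
  rewrite lee_pdivrMl ?invr_gt0// => /le_lt_trans; apply.
  by rewrite lte_mul_pinfty// ?lee_fin//.
(* Dominated convergence with bound [f]: at each point the restricted integrand is eventually 0,
   either because [f x = 0] or because [x] enters [C m]. *)
have tail0 : (\int[mu]_(x in ~` C m) (f x)%:E)%E @[m --> \oo] --> 0%E.
  under eq_fun do rewrite integral_mkcond.
  suff : (\int[mu]_x ((EFin \o f) \_ (~` C m)) x)%E @[m --> \oo] -->
      (\int[mu]_x (0%:E : \bar R))%E by rewrite integral0.
  apply: (@dominated_cvg _ _ _ mu _ measurableT _ _ (EFin \o f)) => //.
  - move=> m; apply/(measurable_restrictT _ _).1 => //; first exact: measurableC.
    exact: measurable_funTS.
  - move=> x _; apply: cvg_near_cst.
    have := f0 x; rewrite le_eqVlt => /predU1P[fx0|fx0].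
      by apply: nearW => m; rewrite patchE /= -fx0; case: ifP.
    near=> m; rewrite patchE memNset// => -[]; rewrite /C/= in_itv/=.
    apply/andP; split.
      by near: m; exact: (near_infty_natSinv_lt (PosNum fx0)).
    near: m; apply: filterS (nbhs_infty_gtr (f x)) => m /ltW /le_trans; apply.
    by rewrite ler_nat.
  - apply/integrableP; split => //.
    by under eq_integral do rewrite /= ger0_norm//.
  - move=> m x _ /=; rewrite patchE; case: ifP => _; rewrite lee_fin ?normr0//.
    by rewrite ger0_norm.
apply/ge0_cvge0P => [k|e e0]; first by apply: integral_ge0 => x _; rewrite lee_fin.
have e20 : 0 < e / 2 by rewrite divr_gt0.
(* This [m] is fixed before [k], since the tail bound does not involve [A k]. *)
have [m _ /(_ _ (leqnn m)) mtail] : \forall m \near \oo,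
    (\int[mu]_(x in ~` C m) (f x)%:E < (e / 2)%:E)%E.
  move/ge0_cvge0P : tail0; apply => // k.
  by apply: integral_ge0 => x _; rewrite lee_fin.
have /ge0_cvge0P/(_ _ e20) ACm : (m.+1%:R%:E * mu (A k `&` C m))%E
    @[k --> \oo] --> 0%E.
  by rewrite -(mule0 m.+1%:R%:E); apply: cvgeZl => //; exact: A0.
have {}ACm := ACm (fun=> mule_ge0 (ler0n _ _ : 0 <= m.+1%:R%:E)%E (measure_ge0 _ _)).
near=> k.
have mAC : measurable (A k `&` C m) by exact: measurableI.
have mAD : measurable (A k `\` C m) by exact: measurableD.
rewrite (splitr e) EFinD -(setUIDK (A k) (C m)).
rewrite ge0_integral_setU//; last 3 first.
- exact: (measurable_funTS mEf).
- by move=> x _; rewrite lee_fin.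
- by apply/disj_setPS => x [[_ Cx] [_ /(_ Cx)]].
apply: lteD.
- apply: (@le_lt_trans _ _ (m.+1%:R%:E * mu (A k `&` C m))%E); last by near: k.
  rewrite -integral_cst//; apply: ge0_le_integral => //.
  + by move=> x _; rewrite lee_fin.
  + exact: (measurable_funTS mEf).
  + by move=> x [_]; rewrite /C/= in_itv/= => /andP[_].
- apply: le_lt_trans mtail; apply: ge0_subset_integral => //.
  + exact: measurableC.
  + exact: (measurable_funTS mEf).
  + by move=> x _; rewrite lee_fin.
Unshelve. all: by end_near. Qed.

Section Qproj_convergence.
Context d (T : measurableType d) (R : realType).
Variable mu : {measure set T -> \bar R}.
Local Notation normc := (@ComplexField.Normc.normc R).

Lemma L2norm_sqr (u : L2fun mu) :
  ((L2norm (\pi_(L2 mu)%qT u)) ^+ 2)%:E = (\int[mu]_x (normc (u x) ^+ 2)%:E)%E.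
Proof.
transitivity ((L2norm (\pi_(L2 mu)%qT u))%:E `^ 2)%E.
  (* Reading [L2norm] as the norm of [L2 mu] supplies the nonnegativity that [powR_mulrn] asks
     for. *)
  by rewrite poweR_EFin powR_mulrn// -[L2norm _]/`|_ : L2 mu|.
rewrite L2normE poweR_Lnorm//; apply: eq_integral => x _ /=.
by rewrite powR_mulrn// real_normK// num_real.
Qed.

Lemma measurable_pos_setY (r s : density mu) :
  measurable (pos_set r `+` pos_set s).
Proof.
by apply: measurableU; apply: measurableD; exact: measurable_pos_set.
Qed.

(** The difference of the two indicators is 1 or -1 on the symmetric difference and 0 elsewhere, and
    the sign disappears in the modulus. *)
Lemma Qproj_sub_normE (r s : density mu) (u : L2fun mu) :
  (`|Qproj r (\pi_(L2 mu)%qT u) - Qproj s (\pi_(L2 mu)%qT u)| ^+ 2)%:E =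
  (\int[mu]_(x in pos_set r `+` pos_set s) (normc (u x) ^+ 2)%:E)%E.
Proof.
rewrite !QprojE -raddfB [LHS]L2norm_sqr [RHS]integral_mkcond.
apply: eq_integral => x _; rewrite patchE /= !fctE /= !indicE in_setU !in_setD.
case: (x \in pos_set r); case: (x \in pos_set s) => /=.
all: rewrite ?mul1r ?mul0r ?subrr ?subr0 ?sub0r ?ComplexField.Normc.normc0 ?expr0n//.
by case: (u x) => a b /=; rewrite !sqrrN.
Qed.

(** The integral is the squared distance; squaring preserves convergence to 0, and continuity of the
    square root at 0 undoes it. *)
Lemma Qproj_cvgP (r_ : nat -> density mu) (r : density mu) (u : L2fun mu) :
  Qproj (r_ k) (\pi_(L2 mu)%qT u) @[k --> \oo] --> Qproj r (\pi_(L2 mu)%qT u) <->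
  (\int[mu]_(x in pos_set (r_ k) `+` pos_set r) (normc (u x) ^+ 2)%:E)%E
    @[k --> \oo] --> 0%E.
Proof.
rewrite (_ : (fun k => \int[mu]_(x in _) _)%E =
    (fun k => (`|Qproj (r_ k) (\pi_(L2 mu)%qT u) - Qproj r (\pi_(L2 mu)%qT u)|
      ^+ 2)%:E)); last by apply/funext => k; rewrite Qproj_sub_normE.
rewrite -subr_cvg0 -norm_cvg0P; split=> [cvg0|/fine_cvgP[_ cvg0]].
  apply: cvg_EFin; first exact: nearW.
  by apply: cvg_trans (cvgM cvg0 cvg0) _; rewrite mulr0.
suff : Num.sqrt (`|Qproj (r_ k) (\pi_(L2 mu)%qT u) - Qproj r (\pi_(L2 mu)%qT u)|
    ^+ 2) @[k --> \oo] --> Num.sqrt (0 : R).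
  rewrite sqrtr0; apply: cvg_trans; apply: near_eq_cvg; apply: nearW => k.
  by rewrite sqrtr_sqr normr_id.
exact: continuous_cvg (@sqrt_continuous R 0) cvg0.
Qed.

Lemma normc_indic_sub (E F : set T) x :
  normc (\1_E x - \1_F x) = \1_(E `+` F) x.
Proof.
rewrite !indicE in_setU !in_setD.
by case: (x \in E); case: (x \in F); rewrite /= ?subrr ?subr0 ?sub0r ?oppr0
  ?sqrrN expr0n ?expr1n addr0 ?sqrtr0 ?sqrtr1.
Qed.

(** The modulus takes only the values 0 and 1, so the threshold matters only through [e < 1]; at
    [e = 1] the strict inequality already leaves nothing. *)
Lemma indic_sub_gtE (E F B : set T) (e : R) : 0 < e ->
  [set x | B x /\ e < normc (\1_E x - \1_F x)] =
  if e < 1 then (E `+` F) `&` B else set0.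
Proof.
move=> e0; have [e1|e1] := ltP e 1; apply/seteqP; split=> x //=.
- case=> Bx; rewrite normc_indic_sub indicE; case: (boolP (x \in _)) => [/set_mem//|_].
  by rewrite ltNge ltW.
- by case=> EFx Bx; rewrite normc_indic_sub indicE mem_set.
- case=> _; rewrite normc_indic_sub indicE ltNge => /negP; apply.
  by rewrite (le_trans _ e1)// lern1 leq_b1.
Qed.

Lemma Qproj_cvg_local_setY (r_ : nat -> density mu) (r : density mu) :
  (forall U : L2 mu, Qproj (r_ k) U @[k --> \oo] --> Qproj r U) ->
  forall B, measurable B -> (mu B < +oo)%E ->
    mu ((pos_set (r_ k) `+` pos_set r) `&` B) @[k --> \oo] --> 0%E.
Proof.
move=> rU B mB Boo.
have normB x : normc (\1_B x) ^+ 2 = \1_B x.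
  by rewrite !indicE; case: (x \in B);
    rewrite /= expr0n addr0 ?expr1n ?sqrtr1 ?sqrtr0 ?expr1n ?expr0n.
(* Finite measure of [B] is what puts its indicator in the space. *)
have B2 : (\1_B : T -> R[i]) \in square_integrable mu.
  rewrite inE /=; split; first exact: complex_measurable_indic.
  rewrite /finite_norm unlock; apply: poweR_lty.
  under eq_integral => x _ do rewrite /= powR_mulrn// real_normK ?num_real// normB.
  by rewrite integral_indic// setIT.
have /Qproj_cvgP := rU (\pi_(L2 mu)%qT (MkL2fun B2)).
apply: cvg_trans; apply: near_eq_cvg; apply: nearW => k /=.
rewrite setIC -integral_indic//; last exact: measurable_pos_setY.
by apply: eq_integral => x _; rewrite normB.
Qed.

Lemma local_setY_cvg_in_measure (r_ : nat -> density mu) (r : density mu) :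
  (forall B, measurable B -> (mu B < +oo)%E ->
    mu ((pos_set (r_ k) `+` pos_set r) `&` B) @[k --> \oo] --> 0%E) ->
  cvg_locally_in_measure mu (fun k => \1_(pos_set (r_ k))) \1_(pos_set r).
Proof.
move=> rB B e mB Boo e0; apply: squeeze_cvge (cvg_cst 0%E) (rB B mB Boo).
apply: nearW => k; rewrite measure_ge0/= indic_sub_gtE//.
case: ifP => // _; rewrite measure0; exact: measure_ge0.
Qed.

Lemma cvg_in_measure_Qproj (r_ : nat -> density mu) (r : density mu) :
  cvg_locally_in_measure mu (fun k => \1_(pos_set (r_ k))) \1_(pos_set r) ->
  forall U : L2 mu, Qproj (r_ k) U @[k --> \oo] --> Qproj r U.
Proof.
move=> rm U; elim/quotW: U => u; apply/Qproj_cvgP.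
have [um _] := set_mem (L2funP u).
apply: cvg_integral_local0.
- by apply: measurable_funX; exact: measurable_normc.
- by move=> x; exact: sqr_ge0.
- by rewrite -L2norm_sqr ltry.
- by move=> k; exact: measurable_pos_setY.
(* A single threshold below 1, here 1/2, recovers the whole symmetric difference inside [B]. *)
move=> B mB Boo; apply: cvg_trans (rm B 2^-1 mB Boo _) => //.
apply: near_eq_cvg; apply: nearW => k; rewrite indic_sub_gtE// ifT//.
by rewrite invf_lt1 ?ltr1n.
Qed.

End Qproj_convergence.

Theorem theorem8p1 (R : realType) (n : nat) (n_gt0 : (0 < n)%N)
    (rho_ : nat -> density (@lebesgue_Rn R n)) (rho : density (@lebesgue_Rn R n)) :
  [<-> forall u : L2 (@lebesgue_Rn R n), Qproj (rho_ k) u @[k --> \oo] --> Qproj rho u;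
       forall B : set (Rn R n), measurable B -> (lebesgue_Rn B < +oo)%E ->
         lebesgue_Rn ((pos_set (rho_ k) `+` pos_set rho) `&` B) @[k --> \oo]
           --> 0%E;
       cvg_locally_in_measure (@lebesgue_Rn R n)
         (fun k => \1_(pos_set (rho_ k))) \1_(pos_set rho) ].
Proof.
(* The goals form the cycle 1 to 2, 2 to 3, 3 to 1. *)
tfae.
- exact: Qproj_cvg_local_setY.
- exact: local_setY_cvg_in_measure.
- exact: cvg_in_measure_Qproj.
Qed.
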